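(* Let $n\geq 2$ and let $\mathcal{G}=\{G_1, G_2, \ldots , G_{2n-2}\}$ be a family of (not necessarily distinct) nearly balanced bipartite graphs on the common vertex set $[2n-1]$ with the common bipartition $(X, Y)$. If $$\rho (G_i) \geq \rho(K_{n-1,n-1}\cup K_1)$$ for every $i\in [2n-2]$, then $\mathcal{G}$ admits a rainbow Hamilton path unless $G_1=G_2=\cdots =G_{2n-2}\cong K_{n-1,n-1}\cup K_1$.
   Context: All graphs are simple and undirected. $[k]=\{1,2,\ldots,k\}$. A bipartite graph with bipartition $(X,Y)$ is nearly balanced if $|X|-|Y|=1$ (up to interchanging the names of $X$ and $Y$). $\rho(G)$ is the spectral radius of $G$, i.e. the maximum modulus of the eigenvalues of its adjacency matrix. $G\cup H$ denotes disjoint union, and $K_{s,t}$ the complete bipartite graph. $G_i=G_j$ means equality as graphs on the labelled vertex set (same edge set), while $\cong$ denotes isomorphism. For a family $\mathcal{G}=\{G_1,\ldots,G_k\}$ of not necessarily distinct graphs on the same vertex set $V$ and a graph $H$ with $k$ edges and $V(H)\subseteq V$, $H$ is a rainbow copy in $\mathcal{G}$ if there is a bijection $\phi:E(H)\to[k]$ with $e\in E(G_{\phi(e)})$ for all $e\in E(H)$. A rainbow Hamilton path in $\mathcal{G}$ is such an $H$ that is a path visiting every vertex of $V$ exactly once. *)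

(* Defs.v *)
From HB Require Import structures.
From mathcomp Require Import all_boot all_order all_algebra all_field.

Set Implicit Arguments.
Unset Strict Implicit.
Unset Printing Implicit Defensive.

Import Order.TTheory GRing.Theory Num.Theory.
Local Open Scope ring_scope.

Record sgraph (T : finType) := SGraph {
  adj : rel T;
  adj_sym : symmetric adj;
  adj_irr : irreflexive adj
}.

Definition edges (T : finType) (G : sgraph T) : {set {set T}} :=
  [set e : {set T} | [exists x, exists y, adj G x y && (e == [set x; y])]].

Definition iso (T U : finType) (G : sgraph T) (H : sgraph U) : Prop :=
  exists2 f : T -> U, bijective f & forall x y, adj H (f x) (f y) = adj G x y.

Definition union_adj (T U : finType) (G : sgraph T) (H : sgraph U)
    : rel (T + U) :=
  fun a b => match a, b with
             | inl x, inl y => adj G x y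
             | inr x, inr y => adj H x y
             | _, _ => false
             end.

Lemma union_adj_sym (T U : finType) (G : sgraph T) (H : sgraph U) :
  symmetric (union_adj G H).
Proof. by move=> [x|x] [y|y] //=; apply: adj_sym. Qed.

Lemma union_adj_irr (T U : finType) (G : sgraph T) (H : sgraph U) :
  irreflexive (union_adj G H).
Proof. by move=> [x|x] /=; apply: adj_irr. Qed.

Definition disjoint_union (T U : finType) (G : sgraph T) (H : sgraph U)
    : sgraph (T + U)%type :=
  SGraph (union_adj_sym G H) (union_adj_irr G H).

Definition Kbip_adj (s t : nat) : rel ('I_s + 'I_t) :=
  fun a b => match a, b with
             | inl _, inr _ | inr _, inl _ => true
             | _, _ => false
             end.

Lemma Kbip_adj_sym s t : symmetric (@Kbip_adj s t).
Proof. by move=> [x|x] [y|y]. Qed.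

Lemma Kbip_adj_irr s t : irreflexive (@Kbip_adj s t).
Proof. by move=> [x|x]. Qed.

Definition Kbip (s t : nat) : sgraph ('I_s + 'I_t)%type :=
  SGraph (@Kbip_adj_sym s t) (@Kbip_adj_irr s t).

Definition K_adj (m : nat) : rel 'I_m := fun x y => x != y.

Lemma K_adj_sym m : symmetric (@K_adj m).
Proof. by move=> x y; rewrite /K_adj eq_sym. Qed.

Lemma K_adj_irr m : irreflexive (@K_adj m).
Proof. by move=> x; rewrite /K_adj eqxx. Qed.

Definition K (m : nat) : sgraph 'I_m := SGraph (@K_adj_sym m) (@K_adj_irr m).

Definition is_bipartition (T : finType) (G : sgraph T) (X Y : {set T}) : Prop :=
  [/\ X :|: Y = [set: T], X :&: Y = set0 &
      forall x y, adj G x y ->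
        (x \in X) && (y \in Y) || (x \in Y) && (y \in X)].

Definition nearly_balanced (T : finType) (G : sgraph T) (X Y : {set T}) : Prop :=
  is_bipartition G X Y /\ (#|X| = #|Y|.+1 \/ #|Y| = #|X|.+1).

(* Adjacency matrices have integer entries, so all their complex eigenvalues
   are algebraic and working over [algC] loses none of them. *)
Definition adjmx (T : finType) (G : sgraph T) : 'M[algC]_#|T| :=
  \matrix_(i, j) (adj G (enum_val i) (enum_val j))%:R.

Definition spectrum (m : nat) (A : 'M[algC]_m) : seq algC :=
  sval (closed_field_poly_normal (char_poly A)).

(* [algC] is only partially ordered, but moduli are real and nonnegative, so
   this [Num.max] is a genuine maximum: see [spectral_radius_ge] and
   [spectral_radius_attained]. *)
Definition spectral_radius (m : nat) (A : 'M[algC]_m) : algC :=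
  \big[Num.max/0]_(a <- spectrum A) `|a|.

Definition rho (T : finType) (G : sgraph T) : algC := spectral_radius (adjmx G).

Lemma mem_spectrum m (A : 'M[algC]_m) a : (a \in spectrum A) = eigenvalue A a.
Proof.
rewrite eigenvalue_root_char /spectrum.
case: (closed_field_poly_normal _) => r /= ->.
by rewrite (monicP (char_poly_monic A)) scale1r root_prod_XsubC.
Qed.

Lemma max_norm_real (s : seq algC) : \big[Num.max/0]_(b <- s) `|b| \is Num.real.
Proof.
elim: s => [|b s IHs]; first by rewrite big_nil real0.
by rewrite big_cons; apply: max_real; rewrite ?normr_real.
Qed.

Lemma spectral_radius_ge m (A : 'M[algC]_m) a :
  eigenvalue A a -> `|a| <= spectral_radius A.
Proof.
rewrite -mem_spectrum /spectral_radius.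
elim: (spectrum A) => //= b s IHs; rewrite inE big_cons.
rewrite comparable_le_max; last first.
  by apply: real_comparable; rewrite ?normr_real ?max_norm_real.
by case/predU1P=> [->|/IHs ->]; rewrite ?lexx ?orbT.
Qed.

Lemma spectral_radius_attained m (A : 'M[algC]_m) :
  (0 < m)%N -> exists2 a, eigenvalue A a & spectral_radius A = `|a|.
Proof.
move=> m_gt0.
have sN0 : spectrum A != [::].
  rewrite -size_eq0 /spectrum; case: (closed_field_poly_normal _) => r /= E.
  have := size_char_poly A; rewrite E (monicP (char_poly_monic A)) scale1r.
  by rewrite size_prod_XsubC => -[->]; rewrite -lt0n.
suff [a sa E] : exists2 a, a \in spectrum A & spectral_radius A = `|a|.
  by exists a; rewrite -?mem_spectrum.
rewrite /spectral_radius; elim: (spectrum A) sN0 => //= b [|c s] IHs _.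
  exists b; rewrite ?mem_head // big_cons big_nil /Order.max.
  by rewrite normr_lt0.
have [//|a sa E] := IHs; rewrite big_cons E /Order.max.
case: ifP => _; last by exists b; rewrite ?mem_head.
by exists a; rewrite // inE sa orbT.
Qed.

Definition rainbow_copy (T : finType) (k : nat) (G : 'I_k -> sgraph T)
    (H : sgraph T) : Prop :=
  exists phi : {e : {set T} | e \in edges H} -> 'I_k,
    bijective phi /\ forall e, val e \in edges (G (phi e)).

Definition is_hamilton_path (T : finType) (H : sgraph T) : Prop :=
  exists p : seq T,
    [/\ uniq p, forall x, x \in p &
        edges H = [set [set z.1; z.2] | z in zip p (behead p)]].

Definition has_rainbow_hamilton_path (T : finType) (k : nat)
    (G : 'I_k -> sgraph T) : Prop :=
  exists2 H : sgraph T, is_hamilton_path H & rainbow_copy G H.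

(* Main.v *)
(* Let m = n - 1, |X| = m + 1, |Y| = m, and let M i be the set of pairs of X x Y
   that are not edges of G_i.  Counting walks of length 2 from the largest entry
   of an eigenvector gives rho(G_i)^2 <= e(G_i), with equality only if G_i is
   complete bipartite up to isolated vertices; hence |M i| <= m, and
   |M i| = m forces G_i to be K_{m,m} + K_1.
   Let A consist of the m - 1 pairs lying in the largest number of sets M i.
   K_{m+1,m} minus A has a Hamilton path.  If its 2m edges cannot be matched to
   the 2m graphs, Hall's theorem gives t edges that all belong to at least
   2m + 1 - t common sets M i, so t <= m, and each pair of A also lies in at
   least that many.  Then (m - 1 + t)(2m + 1 - t) <= 2m * m, that is
   (t - 1)(m + 1 - t) <= 0, so t = 1 and all the M i equal one m-element set. *)

Require Import Defs.
From HB Require Import structures.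
From mathcomp Require Import all_boot all_order all_algebra all_field.
From mathcomp Require Import zify.

Set Implicit Arguments.
Unset Strict Implicit.
Unset Printing Implicit Defensive.

Import Order.TTheory GRing.Theory Num.Theory.
Local Open Scope ring_scope.

(** * Hall's marriage theorem *)

Section Hall.
Local Open Scope nat_scope.
Variables (A B : finType) (r : A -> B -> bool) (b0 : B).

Let nbh (S : {set A}) : {set B} := [set b | [exists a in S, r a b]].

Let nbhP (S : {set A}) b :
  reflect (exists2 a, a \in S & r a b) (b \in nbh S).
Proof. by rewrite inE; exact: exists_inP. Qed.

(** Halmos-Vaughan induction on the size of [D]; the form relative to [D] and [U] lets both
    recursive calls apply. If a proper nonempty [S] is tight, match [S] first and then [D :\: S]
    into [U :\: nbh S]. If none is, match any [a] to any admissible [b] and delete both. Values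
    outside [D] are arbitrary. *)
Lemma hall_within (D : {set A}) (U : {set B}) :
    (forall S : {set A}, S \subset D -> #|S| <= #|nbh S :&: U|) ->
  exists f : A -> B,
    {in D &, injective f} /\ {in D, forall a, r a (f a) && (f a \in U)}.
Proof.
move Em : #|D| => m; elim/ltn_ind: m D U Em => m IHm D U Em hallD.
have [->|[a aD]] := set_0Vmem D.
  by exists (fun=> b0); split=> x; rewrite ?inE.
have [/existsP[S /and4P[SD S0 SnD tightS]]|/existsPn loose] :=
  boolP [exists S : {set A},
           [&& S \subset D, S != set0, S != D & #|nbh S :&: U| <= #|S|]].
  have ltSD : #|S| < m by rewrite -Em proper_card // properEneq SnD.
  have [|f1 [inj1 f1P]] := IHm _ ltSD S U erefl.
    by move=> S' /subset_trans/(_ SD); apply: hallD.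
  have cDS : #|D :\: S| < m.
    rewrite -Em -(cardsID S D) (setIidPr SD) -[X in X < _]add0n ltn_add2r.
    by rewrite card_gt0.
  have [|f2 [inj2 f2P]] := IHm _ cDS (D :\: S) (U :\: nbh S) erefl.
    (* Hall's condition for [S'] after the reduction: take it for [S :|: S'] and cancel the at most
       [#|S|] neighbours of the tight set [S]. *)
    move=> S' S'D; have := hallD (S :|: S').
    rewrite subUset SD (subset_trans S'D (subsetDl _ _)) => /(_ isT).
    have dSS' : S :&: S' = set0.
      by apply/setP=> x; rewrite !inE; apply/andP=> -[xS /(subsetP S'D)];
         rewrite inE xS.
    rewrite cardsU dSS' cards0 subn0 => le1.
    rewrite -(leq_add2l #|S|) (leq_trans le1) //.
    rewrite -(cardsID (nbh S)) leq_add //.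
      apply: leq_trans tightS; apply/subset_leq_card/subsetP=> b.
      by rewrite !inE => /andP[/andP[_ ->]] ->.
    apply/subset_leq_card/subsetP=> b; rewrite !in_setD !in_setI in_setD.
    case/and3P=> bS /nbhP[c cSS' rcb] ->; rewrite bS !andbT /=.
    apply/nbhP; exists c => //; case/setUP: cSS' => // cS.
    by case/nbhP: bS; exists c.
  have f1S x : x \in S -> f1 x \in nbh S.
    by move=> xS; apply/nbhP; exists x => //; case/andP: (f1P _ xS).
  have f2S x : x \in D -> x \notin S -> f2 x \notin nbh S.
    move=> xD xS; have /f2P : x \in D :\: S by rewrite inE xS.
    by rewrite in_setD => /and3P[].
  exists (fun x => if x \in S then f1 x else f2 x); split; last first.
    move=> x xD; case: ifP => xS; first exact: f1P.
    have /f2P : x \in D :\: S by rewrite inE xS.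
    by rewrite in_setD => /and3P[-> _ ->].
  move=> x y xD yD /=; case: ifP => xS; case: ifP => yS eqf.
  - exact: inj1.
  - by have := f2S _ yD (negbT yS); rewrite -eqf f1S.
  - by have := f2S _ xD (negbT xS); rewrite eqf f1S.
  - by apply: inj2; rewrite // inE ?xS ?yS.
have [b /setIP[/nbhP[a' /set1P-> rab] bU]] : exists b, b \in nbh [set a] :&: U.
  by apply/set0Pn; rewrite -card_gt0; apply: leq_trans (hallD _ _);
     rewrite ?cards1 ?sub1set.
have cDa : #|D :\ a| < m by rewrite -Em (cardsD1 a D) aD.
have [|f [injf fP]] := IHm _ cDa (D :\ a) (U :\ b) erefl.
  move=> S SDa; have [->|[c cS]] := set_0Vmem S; first by rewrite cards0.
  have aS : a \notin S by apply/negP=> /(subsetP SDa); rewrite !inE eqxx.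
  have SD : S \subset D := subset_trans SDa (subD1set _ _).
  (* No proper nonempty subset is tight, so [S] has a spare neighbour that pays for the removal of
     [b]. *)
  have := loose S; rewrite SD /=.
  have -> /= : S != set0 by apply/set0Pn; exists c.
  have -> /= : S != D by apply: contraNneq aS => ->.
  rewrite -ltnNge setIDA (cardsD1 b (_ :&: _)) => lt1.
  by rewrite -ltnS (leq_trans lt1) // -add1n leq_add2r leq_b1.
exists (fun x => if x == a then b else f x); split; last first.
  move=> x xD; case: eqP => [->|/eqP xa]; first by rewrite rab.
  have /fP : x \in D :\ a by rewrite !inE xa.
  by rewrite in_setD1 => /and3P[-> _ ->].
have fb x : x \in D -> x != a -> f x != b.
  move=> xD xa; have /fP : x \in D :\ a by rewrite !inE xa.
  by rewrite in_setD1 => /and3P[].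
move=> x y xD yD /=; case: (eqVneq x a) => [->|xa]; case: (eqVneq y a) => [->|ya] //.
- by move=> eb; have := fb _ yD ya; rewrite -eb eqxx.
- by move=> eb; have := fb _ xD xa; rewrite eb eqxx.
by move=> eqf; apply: injf; rewrite // !inE ?xa ?ya.
Qed.

Lemma hall_marriage :
    (forall S : {set A}, #|S| <= #|[set b | [exists a in S, r a b]]|) ->
  exists2 f : A -> B, injective f & forall a, r a (f a).
Proof.
move=> hallS; have [|f [injf fP]] := @hall_within setT setT.
  by move=> S _; rewrite setIT; apply: hallS.
exists f => [x y|a]; first by apply: injf; rewrite inE.
by case/andP: (fP a (in_setT a)).
Qed.

End Hall.

(** * Subsets of given size carrying the largest values of a function *)

Section LargestValues.
Local Open Scope nat_scope.

(** Greedy choice: each step adds a maximiser of [f] on the rest of [D]. *)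
Lemma largest_values (T : finType) (D : {set T}) (f : T -> nat) k :
    k <= #|D| ->
  exists A : {set T}, [/\ A \subset D, #|A| = k &
    forall a b, a \in A -> b \in D :\: A -> f b <= f a].
Proof.
elim: k => [|k IHk] kD.
  by exists set0; split=> [||a b]; rewrite ?sub0set ?cards0 ?inE.
have [A [AD cA maxA]] := IHk (ltnW kD).
have [b bDA] : exists b, b \in D :\: A.
  by apply/set0Pn; rewrite -card_gt0 cardsD (setIidPr AD) cA subn_gt0.
have [c cDA maxc] := @arg_maxnP _ b (mem (D :\: A)) f bDA.
have /setDP[cD cA'] : c \in D :\: A := cDA.
exists (c |: A); split.
- by rewrite subUset sub1set cD.
- by rewrite cardsU1 cA' cA.
move=> a d /setU1P[->|aA]; rewrite !inE negb_or => /andP[/andP[_ dA] dD].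
  by apply: maxc; rewrite /= inE dA.
by apply: maxA => //; rewrite inE dA.
Qed.

End LargestValues.

(** * Hamilton paths in a complete bipartite graph with few edges removed *)

Section HamiltonPath.
Local Open Scope nat_scope.
Variable T : finType.
Implicit Types (X Y : {set T}) (F : {set T * T}).

Definition bip_avoid X Y F : rel T := fun u v =>
  [&& u \in X, v \in Y & (u, v) \notin F]
  || [&& v \in X, u \in Y & (v, u) \notin F].

(* Induction: delete a pair [x], [y] outside [F] such that [x] meets [F]; it
   can be inserted in front of a vertex [v] of the remaining path unless [F]
   contains [(v, y)] or [(x, prev s v)], which excludes at most [#|F|] of the
   positions [v]. *)
Lemma bip_avoid_hamilton X Y F :
    [disjoint X & Y] -> #|X| = #|Y|.+1 ->
    F \subset setX X Y -> #|F| <= #|Y|.-1 ->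
  exists s, [/\ uniq s, s =i X :|: Y & sorted (bip_avoid X Y F) s].
Proof.
move Em : #|Y| => m; elim: m X Y F Em => [|m IHm] X Y F cY dXY cX sF cF.
  have /cards1P[x ->] : #|X| == 1 by rewrite cX.
  have /eqP := cY; rewrite cards_eq0 => /eqP->.
  by exists [:: x]; split=> // u; rewrite setU0 !inE.
have [x [y [xX yY xyF cF']]] : exists x y, [/\ x \in X, y \in Y, (x, y) \notin F &
    #|F :&: setX (X :\ x) (Y :\ y)| <= m.-1].
  (* [F] has fewer than [#|Y|] pairs, so it cannot contain all pairs starting at [x]. *)
  have pickY x : exists2 y, y \in Y & (x, y) \notin F.
    apply/exists_inP; apply: contraPT cF; rewrite negb_exists_in.
    move/forall_inP=> allF; apply/negP; rewrite /= -ltnNge -cY.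
    rewrite -(card_imset (mem Y) (f := pair x)) => [|? ? [] //].
    apply/subset_leq_card/subsetP=> _ /imsetP[y yY ->].
    by have := allF y yY; rewrite negbK.
  have [F0|[[x y0] zF]] := set_0Vmem F.
    have [x xX] : exists x, x \in X by apply/set0Pn; rewrite -card_gt0 cX.
    have [y yY yF] := pickY x; exists x, y; split=> //.
    by rewrite F0 set0I cards0.
  have /setXP[/= xX _] := subsetP sF _ zF.
  have [y yY yF] := pickY x; exists x, y; split=> //.
  have : #|F :&: setX (X :\ x) (Y :\ y)| < #|F|.
    rewrite proper_card // properE subsetIl /=; apply/subsetPn.
    by exists (x, y0); rewrite // !inE /= eqxx andbF.
  by move/leq_trans/(_ cF) => /=; case: (m).
have yX : y \notin X by apply: contraL yY => /(disjointFr dXY)->.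
have xy : x != y by apply: contraNneq yX => <-.
have [|||||s [us sE srt]] := IHm (X :\ x) (Y :\ y) (F :&: setX (X :\ x) (Y :\ y)).
- by have := cardsD1 y Y; rewrite yY cY => -[].
- by apply: disjointWl (subD1set _ _) (disjointWr (subD1set _ _) dXY).
- by have := cardsD1 x X; rewrite xX cX => -[].
- exact: subsetIr.
- by [].
have [v [vX vx vyF pvF]] : exists v,
    [/\ v \in X, v != x, (v, y) \notin F & (x, prev s v) \notin F].
  (* [prev] is cyclic, so the head of [s] gets the last vertex; this keeps [prev s] injective. The
     pairs of [F] counted by [B1] and by [B2] are distinct, since a common one would be [(x, y)]. *)
  pose B1 := [set v | (v, y) \in F]; pose B2 := [set v | (x, prev s v) \in F].
  have leB : #|B1| + #|B2| <= #|F|.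
    rewrite -(card_imset (mem B1) (f := pair^~ y)) => [|? ? [] //].
    rewrite -(card_imset (mem B2) (f := fun v => (x, prev s v))); last first.
      by move=> u w [/(can_inj (next_prev us))].
    rewrite -cardsUI (_ : _ :&: _ = set0) ?cards0 ?addn0.
      apply/subset_leq_card/subsetP=> z /setUP[] /imsetP[v] + ->;
      by rewrite inE.
    apply/setP=> z; rewrite !inE; apply/andP=> -[/imsetP[u _ ->]].
    by case/imsetP=> w; rewrite inE => + [_ yE]; rewrite -yE (negPf xyF).
  have [v] : exists v, v \in (X :\ x) :\: (B1 :|: B2).
    apply/set0Pn; rewrite -card_gt0.
    have := cardsID (B1 :|: B2) (X :\ x).
    have := subset_leq_card (subsetIr (X :\ x) (B1 :|: B2)).
    have := cardsUI B1 B2; have := cardsD1 x X; rewrite xX cX.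
    by move: cF leB => /=; lia.
  by rewrite !inE negb_or => /andP[/andP[? ?] /andP[? ?]]; exists v.
have {}srt : sorted (bip_avoid X Y F) s.
  apply: sub_sorted srt => a b; rewrite /bip_avoid !inE.
  by case/orP=> /and3P[/andP[-> ->] /andP[-> ->]];
     rewrite /= !andbT => ->; rewrite ?orbT.
have exy : bip_avoid X Y F x y by rewrite /bip_avoid xX yY xyF.
have eyv : bip_avoid X Y F y v by rewrite /bip_avoid vX yY vyF orbT.
have vs : v \in s by rewrite sE !inE vx vX.
case/splitPr: vs us sE srt pvF => p1 p2 us sE srt pvF.
have pE : perm_eq (p1 ++ [:: x, y, v & p2]) [:: x, y & p1 ++ v :: p2].
  by rewrite (perm_catCA p1 [:: x; y]).
have mE : p1 ++ [:: x, y, v & p2] =i X :|: Y.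
  move=> u; rewrite (perm_mem pE) !inE sE !inE.
  case: (eqVneq u x) => [->|_]; first by rewrite xX.
  by case: (eqVneq u y) => [->|_]; first by rewrite yY orbT.
exists (p1 ++ [:: x, y, v & p2]); split=> //.
  have xY : x \notin Y by rewrite (disjointFr dXY xX).
  rewrite (perm_uniq pE) !cons_uniq us in_cons negb_or xy !sE !inE !eqxx.
  by rewrite (negPf xY) (negPf yX) !andbF.
case: p1 us sE srt pvF {pE mE} => [|a p1] us sE /=.
  by move=> srt _; rewrite exy eyv srt.
rewrite !cat_path /= exy eyv /= => /and3P[-> e1 ->] pvF; rewrite andbT /=.
have pvE : prev (a :: p1 ++ v :: p2) v = last a p1.
  rewrite prev_nth inE mem_cat mem_head !orbT index_cat /= eqxx addn0.
  have vp1 : v \notin p1.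
    by move: us; rewrite /= cat_uniq => /and4P[_ _ /norP[]].
  by rewrite (negPf vp1) -cat_cons nth_cat /= ltnSn -last_nth.
have {}pvF : (x, last a p1) \notin F by rewrite -pvE.
rewrite /bip_avoid xX pvF andbT.
(* The predecessor of [v] lies in [Y] because [v] lies in [X], so it can be joined to [x]. *)
case/orP: e1 => /and3P[]; last by move=> _ -> _; rewrite orbT.
by rewrite (disjointFr dXY vX).
Qed.

End HamiltonPath.

Lemma edgesP (T : finType) (G : sgraph T) (e : {set T}) :
  reflect (exists x y, adj G x y /\ e = [set x; y]) (e \in edges G).
Proof.
rewrite inE; apply: (iffP existsP) => [[x /existsP[y /andP[xy /eqP->]]]|].
  by exists x, y.
by case=> x [y [xy ->]]; exists x; apply/existsP; exists y; rewrite xy eqxx.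
Qed.

(** * From an ordering of the vertices to a rainbow Hamilton path *)

Section RainbowPath.
Local Open Scope nat_scope.
Variables (T : finType) (k : nat) (s : seq T) (x0 : T).
Hypotheses (us : uniq s) (ss : size s = k.+1).

Definition path_edge (j : nat) : {set T} := [set nth x0 s j; nth x0 s j.+1].

(** Equality puts [i] in {j, j+1} and [j] in {i, i+1}, which is consistent only for [i = j]. *)
Lemma path_edge_inj (i j : 'I_k) : path_edge i = path_edge j -> i = j.
Proof.
move=> eqc; have [ik jk] := (ltn_ord i, ltn_ord j).
have : nth x0 s i \in path_edge j by rewrite -eqc !inE eqxx.
have : nth x0 s j \in path_edge i by rewrite eqc !inE eqxx.
rewrite !inE !nth_uniq ?ss //; try lia.
by move=> /orP[]/eqP? /orP[]/eqP?; apply: val_inj => /=; lia.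
Qed.

(** A vertex outside [s] has index [size s] and would be adjacent to the last vertex of [s]; the
    hypothesis [sT] below rules such vertices out. *)
Definition path_adj : rel T := fun u v =>
  (index v s == (index u s).+1) || (index u s == (index v s).+1).

Lemma path_adj_sym : symmetric path_adj.
Proof. by move=> u v; rewrite /path_adj orbC. Qed.

Lemma path_adj_irr : irreflexive path_adj.
Proof. by move=> u; rewrite /path_adj; lia. Qed.

Definition path_graph : sgraph T := SGraph path_adj_sym path_adj_irr.

Hypothesis sT : forall x, x \in s.

Lemma path_edgesP e :
  reflect (exists j : 'I_k, e = path_edge j) (e \in edges path_graph).
Proof.
apply: (iffP (edgesP _ _)) => [[x [y [+ ->]]]|[j ->]].
  have lts z : index z s < k.+1 by rewrite -ss index_mem.
  rewrite /= /path_adj /path_edge => /orP[] /eqP iE.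
    have jk : index x s < k by have := lts y; rewrite iE.
    by exists (Ordinal jk); rewrite /= -iE !nth_index.
  have jk : index y s < k by have := lts x; rewrite iE.
  by exists (Ordinal jk); rewrite /= -iE !nth_index // setUC.
exists (nth x0 s j), (nth x0 s j.+1); split=> //.
by rewrite /= /path_adj !index_uniq ?eqxx // ss ltnS // ltnW.
Qed.

Lemma path_graph_hamilton : is_hamilton_path path_graph.
Proof.
exists s; split=> //; apply/setP=> e.
have szz : size (zip s (behead s)) = k.
  by rewrite size_zip size_behead ss; lia.
apply/path_edgesP/imsetP => [[j ->]|[z /(nthP (x0, x0))[j]]].
  exists (nth x0 s j, nth x0 s j.+1) => //=.
  apply/(nthP (x0, x0)); exists j; rewrite ?szz //.
  by rewrite nth_zip_cond szz ltn_ord nth_behead.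
rewrite szz nth_zip_cond szz => jk; rewrite jk nth_behead => <- ->.
by exists (Ordinal jk).
Qed.

(** The bijection sends an edge to [f] of its position along [s]: positions are unique by
    [path_edge_inj], and an injective self-map of a finite set is bijective. *)
Lemma has_rainbow_path (G : 'I_k -> sgraph T) (f : 'I_k -> 'I_k) :
    injective f ->
    (forall j : 'I_k, adj (G (f j)) (nth x0 s j) (nth x0 s j.+1)) ->
  has_rainbow_hamilton_path G.
Proof.
move=> injf fP; exists path_graph; first exact: path_graph_hamilton.
have exj (e : {e : {set T} | e \in edges path_graph}) :
    exists j : 'I_k, val e == path_edge j.
  by case: e => e /= /path_edgesP[j ->]; exists j.
pose h e := xchoose (exj e).
have hP e : val e = path_edge (h e) by apply/eqP/(xchooseP (exj e)).
have gP (j : 'I_k) : path_edge j \in edges path_graph.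
  by apply/path_edgesP; exists j.
exists (f \o h); split.
  apply: bij_comp; first exact: injF_bij.
  exists (fun j => exist (fun e => is_true (e \in _)) _ (gP j)) => [e|j]; first exact/val_inj/esym/hP.
  by apply: path_edge_inj; rewrite -hP.
by move=> e; rewrite hP; apply/edgesP; do 2 eexists; split; first exact: fP.
Qed.

End RainbowPath.

(** * Eigenvectors as functions on the vertices *)

Lemma exists_max_real (T : finType) (f : T -> algC) (x0 : T) :
  (forall x, f x \is Num.real) -> exists x, forall y, f y <= f x.
Proof.
(* [algC] is only partially ordered, so the maximum is built along a list by comparing real values;
   [x0] keeps the list nonempty. *)
move=> fR; suff [x xP] : exists x, forall y, y \in x0 :: enum T -> f y <= f x.
  by exists x => y; apply: xP; rewrite inE mem_enum orbT.
elim: (enum T) => [|y s [x xP]].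
  by exists x0 => y; rewrite inE => /eqP->.
have [le|/ltW le] := real_leP (fR y) (fR x).
  exists x => z; rewrite !inE orbCA -in_cons => /predU1P[->//|/xP//].
exists y => z; rewrite !inE orbCA -in_cons => /predU1P[->//|/xP].
by move/le_trans; apply.
Qed.

(** Removes the enumeration of [T] from the matrix; [eigenvalue] uses row vectors, hence the sum
    over the first argument of [adj]. *)
Lemma eigenvalue_adjmxP (T : finType) (G : sgraph T) (a : algC) :
  eigenvalue (adjmx G) a <->
  exists2 f : T -> algC, exists x, f x != 0 &
    forall y, \sum_(x | adj G x y) f x = a * f y.
Proof.
split=> [/eigenvalueP[v vA v0]|[f [x fx] fA]].
  exists (fun x => v 0 (enum_rank x)).
    have [j vj] : exists j, v 0 j != 0 by apply/rV0Pn.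
    by exists (enum_val j); rewrite enum_valK.
  move=> y; have /rowP/(_ (enum_rank y)) := vA; rewrite !mxE => <-.
  rewrite (reindex (fun j : 'I_#|T| => enum_val j)) /=; last first.
    by exists enum_rank => ? _; rewrite ?enum_valK ?enum_rankK.
  rewrite [RHS](bigID (fun j => adj G (enum_val j) y)) /=.
  rewrite [X in _ + X]big1 ?addr0.
    by apply: eq_bigr => j jy; rewrite mxE enum_rankK jy mulr1 enum_valK.
  by move=> j /negPf jy; rewrite mxE enum_rankK jy mulr0.
apply/eigenvalueP; exists (\row_j f (enum_val j)).
  apply/rowP=> j; rewrite !mxE -fA (reindex (fun j : 'I_#|T| => enum_val j)) /=; last first.
    by exists enum_rank => ? _; rewrite ?enum_valK ?enum_rankK.
  rewrite (bigID (fun i => adj G (enum_val i) (enum_val j))) /=.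
  rewrite [X in _ + X]big1 ?addr0.
    by apply: eq_bigr => i ij; rewrite !mxE ij mulr1.
  by move=> i /negPf ij; rewrite !mxE ij mulr0.
by apply/rV0Pn; exists (enum_rank x); rewrite mxE enum_rankK.
Qed.

(** The indicator function of the component [Kbip m m] is an eigenvector with eigenvalue [m]. *)
Lemma rho_Kbip_K1_ge (m : nat) : (0 < m)%N ->
  m%:R <= rho (disjoint_union (Kbip m m) (K 1)).
Proof.
move=> m_gt0; rewrite -[m%:R]ger0_norm ?ler0n //.
apply: spectral_radius_ge; apply/eigenvalue_adjmxP.
exists (fun u => (if u is inl _ then 1 else 0)).
  by exists (inl (inl (Ordinal m_gt0))); rewrite oner_neq0.
have sumI : \sum_(i < m) (1 : algC) = m%:R by rewrite sumr_const card_ord.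
move=> [[j|j]|j]; rewrite !big_sumType /= ?mulr1 ?mulr0.
- by rewrite big_pred0_eq add0r sumI big_pred0_eq addr0.
- by rewrite big_pred0_eq addr0 sumI big_pred0_eq addr0.
by rewrite !big_pred0_eq !add0r big1.
Qed.

Definition bip_edges (T : finType) (G : sgraph T) (X Y : {set T}) :
  {set T * T} := [set z in setX X Y | adj G z.1 z.2].

Lemma is_bipartition_sym (T : finType) (G : sgraph T) (X Y : {set T}) :
  is_bipartition G X Y -> is_bipartition G Y X.
Proof.
by case=> XY dXY eXY; split=> [||x y /eXY]; rewrite 1?setUC 1?setIC 1?orbC.
Qed.

Lemma card_bip_edgesC (T : finType) (G : sgraph T) (X Y : {set T}) :
  #|bip_edges G X Y| = #|bip_edges G Y X|.
Proof.
pose swap (z : T * T) := (z.2, z.1).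
have swapK : involutive swap by case.
rewrite -(card_imset _ (inv_inj swapK)); apply: eq_card => z.
rewrite (can2_imset_pre _ swapK swapK) !inE /=.
by rewrite adj_sym; congr (_ && _); rewrite andbC.
Qed.

(** * Bounding the squared spectral radius by the number of edges *)

Section SpectralBound.
Variables (T : finType) (G : sgraph T) (X Y : {set T}).
Hypothesis bipG : is_bipartition G X Y.
Variables (f : T -> algC) (r : algC).
Hypotheses (f_ge0 : forall x, 0 <= f x) (r_ge0 : 0 <= r).
Hypothesis fP : forall y, r * f y <= \sum_(x | adj G x y) f x.

Lemma bip_adjr x y : y \in Y -> adj G x y -> x \in X.
Proof.
case: bipG => _ dXY eXY yY /eXY /orP[] /andP[//].
by move=> _ yX; have /setP/(_ y) := dXY; rewrite !inE yX yY.
Qed.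

(* A walk [i, x, y] of length 2 from [i] in [Y] is encoded by its last edge
   [(x, y)], so there are at most as many such walks as edges. *)
Let walks (i : T) := [set z in bip_edges G X Y | adj G z.1 i].

(** Apply [fP] at [i] and then at each of its neighbours. As [i] is in [Y], the middle vertex of
    such a walk is in [X] and its end is in [Y]. *)
Lemma two_walk_bound i : i \in Y ->
  r ^+ 2 * f i <= \sum_(z in walks i) f z.2.
Proof.
move=> iY; rewrite expr2 -mulrA.
apply: (@le_trans _ _ (\sum_(x | adj G x i) r * f x)).
  by rewrite -mulr_sumr ler_wpM2l.
apply: le_trans (ler_sum _ (fun x _ => fP x)) _.
rewrite pair_big_dep /= le_eqVlt; apply/predU1l/eq_bigl => -[x y] /=.
rewrite !inE /= [adj G y x]adj_sym; case: (boolP (adj G x i)) => xi; rewrite ?andbF //.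
rewrite andbT; case: (boolP (adj G x y)) => xy; rewrite ?andbF // andbT.
have xX := bip_adjr iY xi; rewrite xX; case: bipG => _ dXY /(_ _ _ xy).
by have /setP/(_ x) := dXY; rewrite !inE xX /= => ->; rewrite orbF => ->.
Qed.

Variable i : T.
Hypotheses (iY : i \in Y) (fi_gt0 : 0 < f i) (fi_max : forall x, f x <= f i).

Let walks_bound : \sum_(z in walks i) f z.2 <= #|walks i|%:R * f i.
Proof.
by rewrite mulr_natl -sumr_const; apply: ler_sum.
Qed.

Let walksE : walks i \subset bip_edges G X Y.
Proof. by apply/subsetP=> z; rewrite inE => /andP[]. Qed.

(** Each walk from the maximiser [i] contributes at most [f i], and there are at most as many walks
    as edges; then divide by [f i]. *)
Lemma sqr_max_bound : r ^+ 2 <= #|bip_edges G X Y|%:R.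
Proof.
rewrite -(ler_pM2r fi_gt0) (le_trans (two_walk_bound iY)) //.
apply: le_trans walks_bound _.
by rewrite ler_pM2r // ler_nat subset_leq_card.
Qed.

(** Equality must hold throughout [sqr_max_bound]: every edge is the last edge of a walk from [i],
    and every walk ends at a vertex of maximal value. *)
Lemma sqr_max_tight : #|bip_edges G X Y|%:R <= r ^+ 2 ->
  forall x y, (x, y) \in bip_edges G X Y -> adj G x i /\ f y = f i.
Proof.
rewrite -(ler_pM2r fi_gt0) => /le_trans/(_ (two_walk_bound iY)) tight.
have wE : walks i = bip_edges G X Y.
  apply/eqP; rewrite eqEcard walksE /= -(ler_nat algC) -(ler_pM2r fi_gt0).
  exact: le_trans tight walks_bound.
have sum0 : \sum_(z in walks i) (f i - f z.2) = 0.
  apply/eqP; rewrite eq_le sumr_ge0 ?andbT; last first.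
    by move=> z _; rewrite subr_ge0.
  by rewrite sumrB sumr_const -mulr_natl subr_le0; move: tight; rewrite wE.
move=> x y xyE; have xyw : (x, y) \in walks i by rewrite wE.
split; first by move: xyw; rewrite inE => /andP[].
apply/esym/eqP; rewrite -subr_eq0; apply/eqP.
have d_ge0 (z : T * T) : z \in walks i -> 0 <= f i - f z.2.
  by rewrite subr_ge0.
exact: (psumr_eq0P d_ge0 sum0 xyw).
Qed.

End SpectralBound.

Section SpectralRadius.
Variables (T : finType) (G : sgraph T) (X Y : {set T}).
Hypothesis bipG : is_bipartition G X Y.

(** The bounds above apply to the moduli [f] of an eigenvector for an eigenvalue of largest modulus,
    by the triangle inequality. In the tight case every non-isolated vertex on the side of the
    maximiser is itself a maximiser, hence adjacent to all non-isolated vertices of the other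
    side. *)
Lemma rho_sqr_bound : (0 < #|T|)%N ->
  rho G ^+ 2 <= #|bip_edges G X Y|%:R /\
  (#|bip_edges G X Y|%:R <= rho G ^+ 2 ->
   forall x y x' y', (x, y') \in bip_edges G X Y ->
     (x', y) \in bip_edges G X Y -> adj G x y).
Proof.
move=> T_gt0; have [a /eigenvalue_adjmxP[g [x0 gx0] ga] ra] :=
  spectral_radius_attained (adjmx G) T_gt0.
rewrite /rho ra; pose f x := `|g x|; pose r := `|a|; rewrite -/r.
have f_ge0 x : 0 <= f x by apply: normr_ge0.
have fP y : r * f y <= \sum_(x | adj G x y) f x.
  by rewrite /r /f -normrM -ga; apply: ler_norm_sum.
have [i imax] := exists_max_real x0 (fun x => ger0_real (f_ge0 x)).
have fi : 0 < f i by rewrite (lt_le_trans _ (imax x0)) // normr_gt0.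
have bipG' := is_bipartition_sym bipG.
have /setUP[iX|iY] : i \in X :|: Y by case: bipG => -> _ _; rewrite inE.
  rewrite card_bip_edgesC; split.
    exact: (sqr_max_bound bipG' (normr_ge0 a) fP iX fi imax).
  move=> tight x y x' y'; rewrite !inE /=.
  case/andP=> /andP[xX y'Y] xy' /andP[/andP[x'X yY] x'y].
  have tE := sqr_max_tight bipG' (normr_ge0 a) fP.
  have E1 : (y', x) \in bip_edges G Y X by rewrite !inE /= y'Y xX adj_sym.
  have E2 : (y, x') \in bip_edges G Y X by rewrite !inE /= yY x'X adj_sym.
  have [_ fx] := tE _ iX fi imax tight _ _ E1.
  (* Since [f x] equals [f i], the tight case can be used again with [x] as the maximiser. *)
  rewrite adj_sym; apply: (proj1 (tE x xX _ _ tight _ _ E2)); by rewrite fx.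
split; first exact: (sqr_max_bound bipG (normr_ge0 a) fP iY fi imax).
move=> tight x y x' y' E1 E2.
have tE := sqr_max_tight bipG (normr_ge0 a) fP.
have [_ fy] := tE _ iY fi imax tight _ _ E2.
have yY : y \in Y by move: E2; rewrite !inE => /andP[/andP[]].
by apply: (proj1 (tE y yY _ _ tight _ _ E1)); rewrite fy.
Qed.

End SpectralRadius.

(** * Non-edges between the two sides, and the extremal graph *)

Section Missing.
Local Open Scope nat_scope.
Variables (T : finType) (X Y : {set T}).

Definition missing (G : sgraph T) : {set T * T} :=
  [set z in setX X Y | ~~ adj G z.1 z.2].

Lemma card_missing G : #|bip_edges G X Y| + #|missing G| = #|X| * #|Y|.
Proof.
rewrite -cardsX -(cardsID [set z | adj G z.1 z.2] (setX X Y)).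
by congr (_ + _); apply: eq_card => z; rewrite !inE // andbC.
Qed.

Lemma inj_ord_on (P : {set T}) k : 0 < k -> #|P| = k ->
  exists g : T -> 'I_k, {in P &, injective g}.
Proof.
move=> k_gt0 cP; have [x0 x0P] : exists x, x \in P.
  by apply/card_gt0P; rewrite cP.
exists (fun x => cast_ord cP (enum_rank_in x0P x)) => x y xP yP.
by move/cast_ord_inj/enum_rank_in_inj; apply.
Qed.

(** [P] and [Y] are mapped to the two sides of [Kbip m m], and the single vertex of [X :\: P] to
    [K 1]. Injectivity and a count of vertices give bijectivity. *)
Lemma iso_Kbip_K1 (G : sgraph T) (P : {set T}) m :
    is_bipartition G X Y -> 0 < m ->
    #|X| = m.+1 -> #|P| = m -> #|Y| = m -> P \subset X ->
    (forall x y, x \in X -> y \in Y -> adj G x y = (x \in P)) ->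
  iso G (disjoint_union (Kbip m m) (K 1)).
Proof.
move=> [XY dXY eXY] m_gt0 cX cP cY PX adjP.
have YX x : x \in Y = (x \notin X).
  have /setP/(_ x) := XY; have /setP/(_ x) := dXY; rewrite !inE.
  by case: (x \in X) => //= ->.
have YP x : x \in Y -> (x \in P) = false.
  by rewrite YX; apply: contraNF => /(subsetP PX).
have [g gI] := inj_ord_on m_gt0 cP; have [h hI] := inj_ord_on m_gt0 cY.
pose f x : ('I_m + 'I_m) + 'I_1 :=
  if x \in P then inl (inl (g x)) else if x \in Y then inl (inr (h x))
  else inr ord0.
have cT : #|T| = 2 * m + 1.
  by rewrite -cardsT -XY cardsU dXY cards0 cX cY; lia.
have c1 : #|X :\: P| = 1 by rewrite cardsD (setIidPr PX) cX cP subSnn.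
have fI : injective f.
  move=> x y; rewrite /f; case xP: (x \in P); case yP: (y \in P).
  - by move=> [] /gI; apply.
  - by case: ifP => _ e; discriminate e.
  - by case: ifP => _ e; discriminate e.
  case: ifP => xY; case: ifP => yY //; first by move=> [] /hI; apply.
  move=> _.
  have /cards1P[z zE] : #|X :\: P| == 1 by rewrite c1.
  have inz u : (u \in P) = false -> (u \in Y) = false -> u = z.
    by rewrite YX => uP /negbFE uX; apply/set1P; rewrite -zE inE uP uX.
  by rewrite (inz x xP xY) (inz y yP yY).
exists f; first by apply: inj_card_bij => //; rewrite !card_sum !card_ord cT; lia.
move=> x y; rewrite /f.
have adjF u v : (u \in X) = (v \in X) -> adj G u v = false.
  move=> uv; apply/negP => /eXY; rewrite !YX uv; by case: (v \in X).
case: (boolP (x \in Y)) => xY; case: (boolP (y \in Y)) => yY.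
- by rewrite !YP // adjF //; move: xY yY; rewrite !YX => /negPf-> /negPf->.
- rewrite (YP x xY) [adj G x y]adj_sym adjP //; last by apply: negbFE; rewrite -YX; apply: negbTE.
  by case: ifP.
- rewrite (YP y yY) adjP //; last by apply: negbFE; rewrite -YX; apply: negbTE.
  by case: ifP.
rewrite adjF; last by move: xY yY; rewrite !YX !negbK => -> ->.
by case: ifP; case: ifP.
Qed.

(** At least [m ^ 2] of the [m.+1 * m] pairs are edges. If exactly [m ^ 2] are, the spectral bound
    is tight and the edges form a product [setX P Q] of the non-isolated vertices, whose size forces
    [#|P| = #|Q| = m]. *)
Lemma missing_bound (G : sgraph T) m :
    is_bipartition G X Y -> 0 < m -> #|X| = m.+1 -> #|Y| = m ->
    (m%:R <= rho G)%R ->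
  #|missing G| <= m /\
  (#|missing G| = m -> iso G (disjoint_union (Kbip m m) (K 1))).
Proof.
move=> bipG m_gt0 cX cY le_rho.
have T_gt0 : 0 < #|T|.
  by apply: leq_trans (max_card (mem Y)); rewrite cY.
have [rho_le tight] := rho_sqr_bound bipG T_gt0.
have le_sqr : ((m ^ 2)%:R <= rho G ^+ 2 :> algC)%R.
  by rewrite natrX lerXn2r ?nnegrE ?ler0n // (le_trans _ le_rho) ?ler0n.
have le_e : m ^ 2 <= #|bip_edges G X Y|.
  by rewrite -(ler_nat algC) (le_trans le_sqr).
have cM := card_missing G; rewrite cX cY in cM.
split=> [|eM]; first by nia.
have eE : #|bip_edges G X Y| = m ^ 2.
  by move: cM; rewrite eM mulSn addnC -mulnn => /addnI.
rewrite eE in tight; have {}tight := tight le_sqr.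
pose P := [set x in X | [exists y in Y, adj G x y]].
pose Q := [set y in Y | [exists x in X, adj G x y]].
have PX : P \subset X by apply/subsetP=> x; rewrite inE => /andP[].
have QY : Q \subset Y by apply/subsetP=> x; rewrite inE => /andP[].
have adjPQ x y : x \in P -> y \in Q -> adj G x y.
  rewrite !inE => /andP[xX /exists_inP[y' y'Y xy']].
  move=> /andP[yY /exists_inP[x' x'X x'y]].
  by apply: (tight x y x' y'); rewrite !inE ?xX ?yY ?x'X ?y'Y.
have EPQ : bip_edges G X Y = setX P Q.
  apply/setP=> -[x y]; rewrite in_setX !inE /=.
  apply/idP/idP => [/andP[/andP[xX yY] xy]|/andP[xP yQ]].
    by rewrite xX yY; apply/andP; split; apply/exists_inP; [exists y|exists x].
  rewrite adjPQ ?inE //.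
  by case/andP: xP => ->; case/andP: yQ => ->.
have cPQ : #|P| * #|Q| = m ^ 2 by rewrite -cardsX -EPQ.
have leP := subset_leq_card PX; have leQ := subset_leq_card QY.
rewrite cX in leP; rewrite cY in leQ.
have [cP cQ] : #|P| = m /\ #|Q| = m.
  move: cPQ leP leQ m_gt0; rewrite -mulnn; move: #|P| #|Q| => p q pq lep leq m_gt0.
  have gep : m <= p by rewrite leqNgt; apply/negP=> ltp; nia.
  have [pE|pE] : p = m \/ p = m.+1 by lia.
    by split=> //; subst p; nia.
  (* The positive number [m] is not a multiple of [m.+1]. *)
  exfalso; subst p; have : m.+1 * (m - q) = m by rewrite mulnBr pq; lia.
  by case: (m - q) => [|d]; rewrite ?mulnS; lia.
have QE : Q = Y by apply/eqP; rewrite eqEcard QY cY cQ /=.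
apply: (iso_Kbip_K1 bipG m_gt0 cX cP cY PX) => x y xX yY.
apply/idP/idP=> [xy|xP]; last by apply: adjPQ; rewrite ?QE.
by rewrite inE xX; apply/exists_inP; exists y.
Qed.

End Missing.

(** * Matching the edges of a Hamilton path to the graphs *)

Section RainbowPositions.
Local Open Scope nat_scope.
Variables (T : finType) (X Y : {set T}) (m k : nat).
Variable M : 'I_k -> {set T * T}.
Hypotheses (m_gt0 : 0 < m) (kE : k = 2 * m).
Hypotheses (dXY : [disjoint X & Y]) (cX : #|X| = m.+1) (cY : #|Y| = m).
Hypothesis (cM : forall i, #|M i| <= m).

Let deg (z : T * T) := #|[set i | z \in M i]|.

(** Double counting of the incidences between pairs in [W] and the sets [M i]. *)
Lemma sum_deg (W : {set T * T}) : \sum_(z in W) deg z <= k * m.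
Proof.
have -> : \sum_(z in W) deg z = \sum_(i < k) #|W :&: M i|.
  under eq_bigr do rewrite /deg -sum1dep_card big_mkcond.
  rewrite exchange_big; apply: eq_bigr => i _.
  rewrite -sum1_card [RHS]big_mkcond [LHS]big_mkcond.
  by apply: eq_bigr => z _; rewrite inE; case: (z \in W).
rewrite -[k in k * m]card_ord -sum_nat_const; apply: leq_sum => i _.
exact: leq_trans (subset_leq_card (subsetIr _ _)) (cM i).
Qed.

Lemma rainbow_positions (x0 : T) :
    ~~ [exists W : {set T * T}, (#|W| == m) && [forall i, M i == W]] ->
  exists s, exists f : 'I_k -> 'I_k,
    [/\ uniq s, s =i X :|: Y, injective f &
        forall j : 'I_k, let: u := nth x0 s j in let: v := nth x0 s j.+1 in
          [&& u \in X, v \in Y & (u, v) \notin M (f j)] ||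
          [&& v \in X, u \in Y & (v, u) \notin M (f j)]].
Proof.
move=> notall.
have leD : m.-1 <= #|setX X Y| by rewrite cardsX cX cY; nia.
have [A [AD cA maxA]] := largest_values deg leD.
have [||s [us sE srt]] := @bip_avoid_hamilton T X Y A dXY _ AD.
- by rewrite cX cY.
- by rewrite cA cY.
have ss : size s = k.+1.
  rewrite -(card_uniqP us) (eq_card sE) cardsU cX cY.
  by have := dXY; rewrite -setI_eq0 => /eqP->; rewrite cards0 kE; lia.
(* The [j]-th path edge, oriented from [X] to [Y] so that it can be compared with [M i]. *)
pose c (j : nat) := let: u := nth x0 s j in let: v := nth x0 s j.+1 in
  if u \in X then (u, v) else (v, u).
have eP (j : 'I_k) : bip_avoid X Y A (nth x0 s j) (nth x0 s j.+1).
  by move/(sortedP x0): srt; apply; rewrite ss ltnS.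
have YX u : u \in Y -> (u \in X) = false.
  by move=> uY; rewrite (disjointFl dXY uY).
have cD (j : 'I_k) : c j \in setX X Y :\: A.
  have := eP j; rewrite /bip_avoid /c.
  by case/orP=> /and3P[uX vY uvA];
     rewrite ?(YX _ vY) ?uX in_setD uvA in_setX /= uX vY.
have cI : {in setT &, injective (fun j : 'I_k => c j)}.
  move=> i j _ _ cij; apply: (path_edge_inj us ss (x0 := x0)).
  have pE (l : nat) : path_edge s x0 l = [set (c l).1; (c l).2].
    by rewrite /path_edge /c; case: ifP => //; rewrite setUC.
  by rewrite !pE cij.
have k_gt0 : 0 < k by rewrite kE; lia.
have [S|f fI fP] := @hall_marriage _ _ (fun (j i : 'I_k) => c j \notin M i) (Ordinal k_gt0).
  set N := [set b | _]; rewrite leqNgt; apply/negP => ltNS.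
  have [j0 j0S] : exists j, j \in S by apply/card_gt0P; apply: leq_trans ltNS.
  have NM j i : j \in S -> i \notin N -> c j \in M i.
    by move=> jS; apply: contraR => cjM; rewrite inE; apply/exists_inP; exists j.
  pose C := [set c j | j : 'I_k in S].
  have cC : #|C| = #|S| by apply: card_in_imset => i j _ _; apply: cI; rewrite inE.
  (* Some index lies outside [N], and its set [M i] contains all of [C]. *)
  have leC : #|S| <= m.
    have [i] : exists i, i \in ~: N.
      apply/card_gt0P; rewrite cardsCs setCK card_ord subn_gt0.
      by apply: leq_trans ltNS _; rewrite -[k in _ <= k]card_ord max_card.
    rewrite inE => iN; rewrite -cC; apply: leq_trans (cM i).
    by apply/subset_leq_card/subsetP=> _ /imsetP[j jS ->]; apply: NM.
  have degC j : j \in S -> k.+1 - #|S| <= deg (c j).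
    move=> jS; apply: (@leq_trans #|~: N|).
      by rewrite [#|~: N|]cardsCs setCK card_ord; lia.
    by apply/subset_leq_card/subsetP=> i; rewrite !in_set => iN; apply: NM; rewrite ?inE.
  have degW z : z \in A :|: C -> k.+1 - #|S| <= deg z.
    case/setUP=> [zA|/imsetP[j jS ->]]; last exact: degC.
    (* The path avoids [A], so [c j0] competed for a place in [A] and its degree bounds those in [A]
       from below. *)
    exact: leq_trans (degC _ j0S) (maxA _ _ zA (cD _)).
  have cW : #|A :|: C| = m.-1 + #|S|.
    rewrite cardsU cA cC (_ : A :&: C = set0) ?cards0 ?subn0 //.
    apply/setP=> z; rewrite !inE; apply/andP=> -[zA /imsetP[j _ zE]].
    by have := cD j; rewrite -zE inE zA.
  have : \sum_(z in A :|: C) (k.+1 - #|S|) <= k * m.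
    by apply: leq_trans (sum_deg (A :|: C)); apply: leq_sum.
  rewrite sum_nat_const cW => le1.
  have S_gt0 : 0 < #|S| by apply/card_gt0P; exists j0.
  have S1 : #|S| = 1.
    by move: kE m_gt0 leC S_gt0 le1; move: #|S| => t; nia.
  (* All [m] pairs of [A :|: C] now have degree [k], so they lie in every [M i], which has at most
     [m] elements. *)
  case/negP: notall; apply/existsP; exists (A :|: C).
  rewrite cW S1 addn1 prednK // eqxx; apply/forallP=> i.
  rewrite eq_sym eqEcard cW S1 addn1 prednK // cM andbT.
  apply/subsetP=> z /degW; rewrite S1 subn1 /= /deg => kd.
  have /eqP/setP/(_ i) : [set i | z \in M i] == setT.
    by rewrite eqEcard subsetT cardsT card_ord.
  by rewrite !inE.
exists s, f; split=> // j; have := fP j; have := eP j; rewrite /bip_avoid /c.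
by case/orP=> /and3P[uX vY _]; rewrite ?uX ?(YX _ vY) ?uX ?vY => -> //; rewrite orbT.
Qed.

End RainbowPositions.

(** * Combination of the spectral and the combinatorial arguments *)

Lemma rainbow_hamilton_of_rho (T : finType) (X Y : {set T}) (m k : nat)
    (G : 'I_k -> sgraph T) :
    (0 < m)%N -> k = (2 * m)%N -> #|X| = m.+1 -> #|Y| = m ->
    (forall i, is_bipartition (G i) X Y) -> (forall i, m%:R <= rho (G i)) ->
    ~ ((forall i j, edges (G i) = edges (G j)) /\
       (forall i, iso (G i) (disjoint_union (Kbip m m) (K 1)))) ->
  has_rainbow_hamilton_path G.
Proof.
move=> m_gt0 kE cX cY bipG rhoG ntight.
have i0 : 'I_k by apply: (@Ordinal _ 0); rewrite kE; lia.
have [XY dXY eXY] := bipG i0.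
have {}dXY : [disjoint X & Y] by rewrite -setI_eq0 dXY.
have bound i := missing_bound (bipG i) m_gt0 cX cY (rhoG i).
have [x0 _] : exists x, x \in Y by apply/card_gt0P; rewrite cY.
have adjE i x y : x \in X -> y \in Y ->
    adj (G i) x y = ((x, y) \notin missing X Y (G i)).
  by move=> xX yY; rewrite !inE /= xX yY negbK.
have [||s [f [us sE fI fP]]] := rainbow_positions m_gt0 kE dXY cX cY
    (M := fun i => missing X Y (G i)) _ x0.
- by move=> i; have [] := bound i.
- apply/existsP=> -[W /andP[/eqP cW /forallP mW]]; apply: ntight; split; last first.
    by move=> i; apply: (proj2 (bound i)); rewrite (eqP (mW i)).
  (* By bipartiteness the set of missing pairs determines the whole graph. *)
  suff adjW i j x y : adj (G i) x y -> adj (G j) x y.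
    move=> i j; apply/setP=> e.
    by apply/edgesP/edgesP=> -[x [y [xy ->]]]; exists x, y; split=> //;
       apply: adjW xy.
  have oriented u v : u \in X -> v \in Y -> adj (G i) u v = adj (G j) u v.
    by move=> uX vY; rewrite !adjE // (eqP (mW i)) (eqP (mW j)).
  move=> xy; have [_ _ /(_ _ _ xy)] := bipG i.
  case/orP=> /andP[]; first by move=> xX yY; rewrite -oriented.
  by move=> xY yX; rewrite adj_sym -oriented // adj_sym.
have ss : size s = k.+1.
  rewrite -(card_uniqP us) (eq_card sE) cardsU cX cY.
  by have := dXY; rewrite -setI_eq0 => /eqP->; rewrite cards0 kE; lia.
apply: (has_rainbow_path us ss _ fI (x0 := x0)) => [x|j].
  by rewrite sE XY inE.
have /orP[] := fP j => /and3P[uX vY]; first by rewrite adjE.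
by rewrite -adjE // adj_sym.
Qed.

Theorem theorem1p4 (n : nat) (hn : (2 <= n)%N)
    (X Y : {set 'I_(2 * n - 1)})
    (G : 'I_(2 * n - 2) -> sgraph 'I_(2 * n - 1))
    (hG : forall i, nearly_balanced (G i) X Y)
    (hrho : forall i,
       rho (disjoint_union (Kbip (n - 1) (n - 1)) (K 1)) <= rho (G i)) :
  ~ ((forall i j, edges (G i) = edges (G j)) /\
     (forall i, iso (G i) (disjoint_union (Kbip (n - 1) (n - 1)) (K 1)))) ->
  has_rainbow_hamilton_path G.
Proof.
have m_gt0 : (0 < n - 1)%N by lia.
have kE : (2 * n - 2 = 2 * (n - 1))%N by lia.
have rhoG i : (n - 1)%:R <= rho (G i).
  exact: le_trans (rho_Kbip_K1_ge m_gt0) (hrho i).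
have i0 : 'I_(2 * n - 2) by apply: (@Ordinal _ 0); lia.
have [[XY dXY _] cXY] := hG i0.
have cT : (#|X| + #|Y| = 2 * n - 1)%N.
  by rewrite -cardsUI XY dXY cards0 addn0 cardsT card_ord.
have bipG i : is_bipartition (G i) X Y by have [] := hG i.
(* Either side may be the larger one; in the second case [X] and [Y] exchange roles. *)
case: cXY => cXY; [have cX : #|X| = (n - 1).+1 by lia|have cY : #|Y| = (n - 1).+1 by lia].
  have cY : #|Y| = (n - 1)%N by lia.
  exact: rainbow_hamilton_of_rho m_gt0 kE cX cY bipG rhoG.
have cX : #|X| = (n - 1)%N by lia.
apply: rainbow_hamilton_of_rho m_gt0 kE cY cX _ rhoG => i.
exact/is_bipartition_sym/bipG.
Qed.
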